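(* Let $N\ge 2$, $R>0$, $Q_{2R}=(-R,R)^N$, and let $B_\rho\subset\mathbb{R}^N$ be the ball of radius $\rho>0$ with $|B_\rho|=|Q_{2R}|$. Then $$\mu_1^+(B_\rho)>\mu_1^+(Q_{2R}).$$ That is, the ball has a larger principal eigenvalue than the cube having the same measure.
   Context: For a symmetric real $N\times N$ matrix $X$, $\mathcal{P}^+_1(X)=\lambda_N(X)$ denotes its largest eigenvalue. For a bounded domain $\Omega\subset\mathbb{R}^N$, the principal eigenvalue of $\mathcal{P}^+_1$ in $\Omega$ is $$\mu_1^+(\Omega)=\sup\{\mu\in\mathbb{R} : \exists\, \phi>0 \text{ in } \Omega,\ \mathcal{P}^+_1(D^2\phi)+\mu\phi\le 0 \text{ in }\Omega\},$$ where $\phi$ is lower semicontinuous and the inequality is understood in the viscosity sense. $|\cdot|$ denotes Lebesgue measure in $\mathbb{R}^N$. *)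

(* Defs.v *)
From HB Require Import structures.
From mathcomp Require Import all_boot all_order all_algebra.
From mathcomp Require Import all_classical all_reals all_analysis.

Set Implicit Arguments.
Unset Strict Implicit.
Unset Printing Implicit Defensive.
Import Order.TTheory GRing.Theory Num.Theory.
Import numFieldNormedType.Exports.

Local Open Scope classical_set_scope.
Local Open Scope ring_scope.
Local Open Scope measure_display_scope.

(* The sigma-finite structure of [m1 \x m2] is not found by unification when
   [m1] and [m2] are not probabilities, hence this alias. *)
Section sigma_finite_product.
Context {d1 d2 : measure_display} {T1 : measurableType d1}
  {T2 : measurableType d2} {R : realType}.
Variables (m1 : {sigma_finite_measure set T1 -> \bar R})
  (m2 : {sigma_finite_measure set T2 -> \bar R}).
Local Open Scope ereal_scope.

Definition sfprod : set (T1 * T2) -> \bar R := m1 \x m2.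

HB.instance Definition _ := Measure.on sfprod.

Let sigma_finite_sfprod : sigma_finite setT sfprod.
Proof.
have /sigma_finiteP[F [TF ndF Foo]] := sigma_finiteT m1.
have /sigma_finiteP[G [TG ndG Goo]] := sigma_finiteT m2.
exists (fun n => F n `*` G n).
  rewrite -setXTT TF TG predeqE => -[x y]; split.
    move=> [/= [n _ Fnx] [k _ Gky]]; exists (maxn n k) => //; split.
    - by move: x Fnx; exact/subsetPset/ndF/leq_maxl.
    - by move: y Gky; exact/subsetPset/ndG/leq_maxr.
  by move=> [n _ []/= ? ?]; split; exists n.
move=> k; have [? ?] := Foo k; have [? ?] := Goo k.
split; first exact: measurableX.
by rewrite /sfprod product_measure1E// lte_mul_pinfty// ge0_fin_numE.
Qed.

HB.instance Definition _ :=
  Measure_isSigmaFinite.Build _ _ _ sfprod sigma_finite_sfprod.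

End sigma_finite_product.

(* R^n as the iterated product R * (R * ... (R * unit)), with the product
   sigma-algebra and the product of n copies of [lebesgue_measure]. *)
Fixpoint prodR_display (R : realType) (n : nat) : measure_display :=
  if n is m.+1 then
    measure_prod_display (R.-ocitv.-measurable.-sigma, prodR_display R m)
  else default_measure_display.

Fixpoint prodR (R : realType) (n : nat) : measurableType (prodR_display R n) :=
  if n is m.+1 then (measurableTypeR R * prodR R m)%type else unit.

Fixpoint prod_lebesgue (R : realType) (n : nat) :
    {sigma_finite_measure set (prodR R n) -> \bar R} :=
  match n return {sigma_finite_measure set (prodR R n) -> \bar R} with
  | 0 => [the {sigma_finite_measure set unit -> \bar R} of \d_ tt]
  | m.+1 => [the {sigma_finite_measure set (measurableTypeR R * prodR R m)%type
                  -> \bar R} of sfprod (@lebesgue_measure R) (prod_lebesgue R m)]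
  end.

Fixpoint row_of_prodR (R : realType) (n : nat) : prodR R n -> 'rV[R]_n :=
  match n return prodR R n -> 'rV[R]_n with
  | 0 => fun=> 0
  | m.+1 => fun x => row_mx (x.1%:M : 'M[R]_1) (row_of_prodR x.2)
  end.

(* The product measure transported along the bijection [row_of_prodR]: this is
   the n-dimensional Lebesgue measure of the Borel sets A. *)
Definition lebesgue_rV (R : realType) (n : nat) (A : set 'rV[R]_n) : \bar R :=
  prod_lebesgue R n (@row_of_prodR R n @^-1` A).

Section viscosity.
Variables (R : realType) (N : nat).
Implicit Types (Omega : set 'rV[R]_N) (phi psi : 'rV[R]_N -> R).
Implicit Types (x y : 'rV[R]_N).

Definition partial (i : 'I_N) psi : 'rV[R]_N -> R :=
  fun x => 'D_(delta_mx 0 i) psi x.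

Definition hessian psi x : 'M[R]_N :=
  \matrix_(i, j) partial j (partial i psi) x.

(* C^2(Omega), for Omega open. *)
Definition C2_on Omega psi := forall x, Omega x ->
  {for x, continuous psi} /\
  forall i, [/\ derivable psi x (delta_mx 0 i),
    {for x, continuous (partial i psi)} &
    forall j, derivable (partial i psi) x (delta_mx 0 j) /\
      {for x, continuous (partial j (partial i psi))}].

(* For symmetric X and N > 0 the set is finite and nonempty, so that the sup is
   the largest eigenvalue. *)
Definition P1plus (X : 'M[R]_N) : R := sup [set a | eigenvalue X a].

Definition lsc_on Omega phi :=
  lower_semicontinuous ((fun x => (phi x)%:E) : subspace Omega -> \bar R).

(* P1plus (D^2 phi) + mu phi <= 0 in Omega, in the viscosity sense: C^2 test
   functions touching phi from below. *)
Definition visc_supersol Omega (mu : R) phi := forall psi x,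
  C2_on Omega psi -> Omega x ->
  (\forall y \near x, phi x - psi x <= phi y - psi y) ->
  P1plus (hessian psi x) + mu * phi x <= 0.

(* Extended-real valued, so that the supremum is meaningful even when the set is
   empty or unbounded. *)
Definition mu1plus Omega : \bar R :=
  ereal_sup [set mu%:E | mu in [set mu : R | exists phi,
    [/\ lsc_on Omega phi, (forall x, Omega x -> 0 < phi x) &
        visc_supersol Omega mu phi]]].

Definition cube (r : R) : set 'rV[R]_N :=
  [set x | forall i, - r < x 0 i < r].

(* [ball] and the norm of the library are those of the sup norm on row
   vectors. *)
Definition eball (rho : R) : set 'rV[R]_N :=
  [set x | Num.sqrt (\sum_i x 0 i ^+ 2) < rho].

End viscosity.

Arguments cube {R} N r.
Arguments eball {R} N rho.

(* Main.v *)
Require Import Defs.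
From mathcomp Require Import all_boot all_order all_algebra.
From mathcomp Require Import all_classical all_reals all_analysis.
From mathcomp Require Import measurable_realfun.
From mathcomp Require Import ring lra.
Set Implicit Arguments.
Unset Strict Implicit.
Unset Printing Implicit Defensive.
Import Order.TTheory GRing.Theory Num.Theory.
Import numFieldNormedType.Exports.
Local Open Scope classical_set_scope.
Local Open Scope ring_scope.

(* A positive supersolution phi of P1plus (D^2 phi) + mu phi <= 0 satisfies
   phi'' + mu phi <= 0 on every segment, so mu1plus is governed by the length of
   the longest segment of the domain.

   Cube: the diagonal gives mu <= (pi / (2 r sqrt N))^2. The test function is
   cos (a s(x)) (1 - K q(x)), where s is the sum of the coordinates and q the
   squared distance to the diagonal. Its second derivative along the diagonal is
   exactly -a^2 N^2 times itself, so touching phi from below inside the thin tube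
   where it is positive bounds mu by a^2 N, for every a > pi / (2 r N).

   Ball: cos (pi |x| / (2 rho)) is a supersolution with mu = (pi / (2 rho))^2.
   Convexity of t |-> cos (sqrt t) on [0, pi^2] bounds its second difference in
   every direction, including at the origin.

   Equality of measures forces rho < r sqrt N, as otherwise the ball contains the
   cube and a further box, and the two bounds are strictly ordered. *)

(** * Quadratic forms and the largest eigenvalue *)

Lemma continuous_sumr (T : topologicalType) (R : realType) (I : Type) (s : seq I)
    (f : I -> T -> R) (x : T) :
  (forall i, {for x, continuous (f i)}) ->
  {for x, continuous (fun y => \sum_(i <- s) f i y)}.
Proof.
move=> cf; elim: s => [|i s IH].
  rewrite (_ : (fun _ => _) = cst 0); first exact: cst_continuous.
  by apply/funext => y; rewrite big_nil.
rewrite (_ : (fun _ => _) = (f i \+ fun y => \sum_(i <- s) f i y)).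
  exact: continuousD.
by apply/funext => y; rewrite big_cons.
Qed.

Section quadratic_form.
Variables (R : realType) (n : nat).
Implicit Types (X : 'M[R]_n) (v w : 'rV[R]_n).

Definition bform X v w : R := (v *m X *m w^T) 0 0.

Lemma bformDl X u v w : bform X (u + v) w = bform X u w + bform X v w.
Proof. by rewrite /bform !mulmxDl mxE. Qed.

Lemma bformZl X a v w : bform X (a *: v) w = a * bform X v w.
Proof. by rewrite /bform -!scalemxAl mxE. Qed.

Lemma bformDr X u v w : bform X w (u + v) = bform X w u + bform X w v.
Proof. by rewrite /bform raddfD mulmxDr mxE. Qed.

Lemma bformZr X a v w : bform X w (a *: v) = a * bform X w v.
Proof. by rewrite /bform linearZ -scalemxAr mxE. Qed.

Lemma bformC X v w : X^T = X -> bform X v w = bform X w v.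
Proof.
move=> sX; rewrite /bform -[in LHS](trmxK (v *m X *m w^T)) mxE.
by rewrite !trmx_mul trmxK sX mulmxA.
Qed.

Lemma bformE X v w : bform X v w = \sum_i \sum_j v 0 i * w 0 j * X i j.
Proof.
rewrite exchange_big /bform !mxE; apply: eq_bigr => j _.
by rewrite !mxE mulr_suml; apply: eq_bigr => i _; rewrite mulrAC.
Qed.

Lemma bform1E v : bform 1%:M v v = \sum_i v 0 i ^+ 2.
Proof.
by rewrite /bform mulmx1 !mxE; apply: eq_bigr => j _; rewrite !mxE.
Qed.

Lemma bform1_ge0 v : 0 <= bform 1%:M v v.
Proof. by rewrite bform1E sumr_ge0// => i _; exact: sqr_ge0. Qed.

Lemma bform1_eq0 v : bform 1%:M v v = 0 -> v = 0.
Proof.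
rewrite bform1E => /eqP; rewrite psumr_eq0; last by move=> i _; exact: sqr_ge0.
move=> /allP v0; apply/rowP => i; rewrite mxE; apply/eqP.
by rewrite -(sqrf_eq0 (v 0 i)); apply: v0; rewrite mem_index_enum.
Qed.

Lemma continuous_bform X : continuous (fun v => bform X v v).
Proof.
rewrite (_ : (fun v => _) = fun v => \sum_i \sum_j v 0 i * v 0 j * X i j).
  move=> v; apply: continuous_sumr => i; apply: continuous_sumr => j.
  apply: continuousM; last exact: cst_continuous.
  by apply: continuousM; exact: coord_continuous.
by apply/funext => v; rewrite bformE.
Qed.

Lemma compact_sphere : compact [set v | bform 1%:M v v = 1].
Proof.
have cI : compact [set v : 'rV[R]_n | forall i, `[-1, 1]%classic (v ord0 i)].
  apply: (@rV_compact R n (fun=> `[-1, 1]%classic)) => _.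
  exact: segment_compact.
apply: subclosed_compact cI _.
  rewrite (_ : mkset _ = (fun v => bform 1%:M v v) @^-1` [set 1])//.
  apply: preimage_closed; last exact: closed_eq.
  by move=> v _; exact: continuous_bform.
move=> v /= v1 i; rewrite in_itv/=.
have : v 0 i ^+ 2 <= 1.
  rewrite -v1 bform1E (bigD1 i)//= lerDl sumr_ge0// => j _; exact: sqr_ge0.
by move=> ?; apply/andP; split; nra.
Qed.

(* M is the maximum of the Rayleigh quotient, attained at v: M - X is positive
   semidefinite and its form vanishes at v, so v is in its kernel. *)
Lemma symmetric_max_eigenvalue X : (0 < n)%N -> X^T = X ->
  exists M, eigenvalue X M /\ forall w, bform X w w <= M * bform 1%:M w w.
Proof.
move=> n0 sX.
have [] := @EVT_max_rV R n (fun v => bform X v v) [set v | bform 1%:M v v = 1].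
- pose i0 := Ordinal n0; exists (delta_mx 0 i0) => /=; rewrite bform1E.
  rewrite (bigD1 i0)//= big1 ?addr0.
    by rewrite mxE !eqxx expr1n.
  by move=> j /negPf ji; rewrite mxE eqxx/= ji expr0n.
- exact: compact_sphere.
- by apply: continuous_subspaceT; exact: continuous_bform.
move=> v; rewrite inE /= => v1 vmax.
set M := bform X v v.
have wM w : bform X w w <= M * bform 1%:M w w.
  have [w0|] := eqVneq (bform 1%:M w w) 0.
    by rewrite w0 (bform1_eq0 w0) mulr0 -(scale0r 0) bformZl mul0r.
  move=> w0; have {}w0 : 0 < bform 1%:M w w by rewrite lt0r w0 bform1_ge0.
  pose s := Num.sqrt (bform 1%:M w w).
  have s0 : 0 < s by rewrite sqrtr_gt0.
  have s2 : s ^+ 2 = bform 1%:M w w by rewrite sqr_sqrtr ?ltW.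
  have : bform X (s^-1 *: w) (s^-1 *: w) <= M.
    apply: vmax; rewrite inE /= bformZl bformZr -s2.
    by field; rewrite gt_eqF.
  rewrite bformZl bformZr mulrA -invfM -expr2 s2 => h.
  by rewrite -ler_pdivrMr// mulrC.
exists M; split => //; apply/eigenvalueP; exists v; last first.
  apply/eqP => v0; move: v1; rewrite v0 -(scale0r 0) bformZl mul0r => /esym/eqP.
  by rewrite oner_eq0.
have key w : bform X v w = M * bform 1%:M v w.
  set b := bform X v w - M * bform 1%:M v w.
  set c := M * bform 1%:M w w - bform X w w.
  have c0 : 0 <= c by rewrite subr_ge0.
  have h t : 0 <= c * t ^+ 2 - 2 * t * b.
    have := wM (v + t *: w).
    rewrite !(bformDl, bformDr, bformZl, bformZr) v1 -/M.
    rewrite (bformC w v sX) (bformC w v (trmx1 _ _)) /b /c => h.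
    by nra.
  suff : b = 0 by rewrite /b => /eqP; rewrite subr_eq0 => /eqP.
  apply/eqP/negP => /negP b0.
  have := h (b / (c + 1)).
  rewrite leNgt => /negP; apply.
  have b2 : 0 < b ^+ 2 by rewrite lt0r sqrf_eq0 b0 sqr_ge0.
  rewrite (_ : _ - _ = - (b ^+ 2 * (c + 2) / (c + 1) ^+ 2)); last first.
    by field; rewrite gt_eqF// ltr_wpDl.
  have c1 : 0 < c + 1 by lra.
  have c2 : 0 < c + 2 by lra.
  by rewrite oppr_lt0; apply: divr_gt0; [exact: mulr_gt0|exact: exprn_gt0].
apply/rowP => i; rewrite !mxE.
have := key (delta_mx 0 i).
rewrite /bform trmx_delta -!colE mulmx1 !mxE => <-.
by [].
Qed.

Lemma P1plus_max X : (0 < n)%N -> X^T = X ->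
  eigenvalue X (P1plus X) /\
  forall w, bform X w w <= P1plus X * bform 1%:M w w.
Proof.
move=> n0 sX; have [M [eM wM]] := symmetric_max_eigenvalue n0 sX.
suff -> : P1plus X = M by [].
have ubM : ubound [set a | eigenvalue X a] M.
  move=> a /= /eigenvalueP[v vX v0].
  have := wM v; rewrite {1}/bform vX -scalemxAl mxE.
  have -> : (v *m v^T) 0 0 = bform 1%:M v v by rewrite /bform mulmx1.
  rewrite ler_pM2r// lt0r bform1_ge0 andbT.
  by apply: contra_neq v0; exact: bform1_eq0.
apply/le_anti/andP; split.
  by apply: ge_sup => //; exists M.
by apply: ub_le_sup => //; exists M.
Qed.

End quadratic_form.

(** * Directional derivatives *)

Section calculus.
Variable R : realType.

Lemma MVT0 (g dg : R -> R) (a : R) :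
  (forall s : R, `|s| <= `|a| -> is_derive s 1 g (dg s)) ->
  exists2 c, `|c| <= `|a| & g a - g 0 = dg c * a.
Proof.
move=> dgP.
have cont (b c : R) : (forall s, s \in `[b, c] -> `|s| <= `|a|) ->
    {within `[b, c], continuous g}.
  move=> bc; apply: derivable_within_continuous => s /bc sa.
  exact/ex_derive/dgP.
have [a0|a0] := leP 0 a.
  have sub s : s \in `[0, a] -> `|s| <= `|a|.
    by rewrite in_itv/= => /andP[s0 sa]; rewrite !ger0_norm.
  have [c c0a h] := MVT_segment a0
    (fun s sI => dgP s (sub s (subset_itv_oo_cc sI))) (cont _ _ sub).
  by exists c; [exact: sub|rewrite h subr0].
have sub s : s \in `[a, 0] -> `|s| <= `|a|.
  by rewrite in_itv/= => /andP[s0 sa]; rewrite !ler0_norm ?lerN2// ltW.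
have [c c0a h] := MVT_segment (ltW a0)
  (fun s sI => dgP s (sub s (subset_itv_oo_cc sI))) (cont _ _ sub).
by exists c; [exact: sub|rewrite -opprB h sub0r mulrN opprK].
Qed.

Variable V : normedModType R.
Implicit Types (f : V -> R) (u v x y : V).

Lemma is_derive_line f u y (t : R) : derivable f (t *: u + y) u ->
  is_derive t 1 (fun s : R => f (s *: u + y)) ('D_u f (t *: u + y)).
Proof.
have E : (fun h : R => h^-1 *: (((fun s : R => f (s *: u + y)) \o shift t) (h *: 1) -
    f (t *: u + y))) =
  (fun h : R => h^-1 *: ((f \o shift (t *: u + y)) (h *: u) - f (t *: u + y))).
  apply/funext => h /=; rewrite -[h *: 1]/(h * 1) mulr1.
  by rewrite scalerDl addrA.
move=> df; apply: DeriveDef; first by rewrite /derivable E.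
by rewrite /derive E.
Qed.

Lemma near_ballP x (P : V -> Prop) : (\forall y \near x, P y) ->
  exists2 d : R, 0 < d & forall y, `|y - x| < d -> P y.
Proof.
move=> /nbhs_normP[d d0 h]; exists d => // y yx; apply: h => /=.
by rewrite /ball_/= distrC.
Qed.

Lemma derive_strict f u x : (\forall y \near x, derivable f y u) ->
  {for x, continuous ('D_u f)} -> forall e, 0 < e ->
  exists2 d : R, 0 < d & forall y (t : R), `|y - x| < d -> `|t| < d ->
    `|f (t *: u + y) - f y - t * 'D_u f x| <= e * `|t|.
Proof.
move=> /near_ballP[d1 d10 df] cf e e0.
have /near_ballP[d2 d20 dc] : \forall y \near x, `|'D_u f x - 'D_u f y| <= e.
  by move/cvgrPdist_le : cf; exact.
have u1 : 0 < 1 + `|u| by rewrite ltr_pwDl.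
pose m := Num.min d1 d2; have m0 : 0 < m by rewrite lt_min d10.
pose d := m / (1 + `|u|).
have d0 : 0 < d by rewrite divr_gt0.
have dm : d * (1 + `|u|) = m by rewrite divfK// gt_eqF.
exists d => // y t yx td.
have in_ball (s : R) : `|s| <= `|t| -> `|s *: u + y - x| < m.
  move=> st; rewrite -addrA (le_lt_trans (ler_normD _ _))//.
  rewrite normrZ -dm; have := normr_ge0 u; have := normr_ge0 s.
  by move: yx td st; move: `|y - x| `|u| `|s| `|t| => a b c h; nra.
have [s st|c ct] := @MVT0 (fun s => f (s *: u + y))
    (fun s => 'D_u f (s *: u + y)) t.
  apply/is_derive_line/df; rewrite (lt_le_trans (in_ball _ st))//.
  by rewrite ge_min lexx.
rewrite scale0r add0r => ->; rewrite mulrC -mulrBr normrM mulrC.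
rewrite ler_wpM2r// distrC dc// (lt_le_trans (in_ball _ ct))//.
by rewrite ge_min lexx orbT.
Qed.

Lemma derive_strict_sum (I : Type) (c : I -> R) (u : I -> V) f x (s : seq I) :
  (forall i, \forall y \near x, derivable f y (u i)) ->
  (forall i, {for x, continuous ('D_(u i) f)}) -> forall e, 0 < e ->
  exists2 d : R, 0 < d & forall y (t : R), `|y - x| < d -> `|t| < d ->
    `|f (t *: (\sum_(i <- s) c i *: u i) + y) - f y -
      t * \sum_(i <- s) c i * 'D_(u i) f x| <= e * `|t|.
Proof.
move=> df cf; elim: s => [|i s IH] e e0.
  exists 1 => // y t _ _; rewrite !big_nil scaler0 add0r mulr0 subr0 subrr.
  by rewrite normr0 mulr_ge0// ltW.
have e20 : 0 < e / 2 by rewrite divr_gt0.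
have c1 : 0 < 1 + `|c i| by rewrite ltr_pwDl.
have [d1 d10 h1] := IH _ e20.
have [d2 d20 h2] := derive_strict (df i) (cf i) (divr_gt0 e20 c1).
pose w := \sum_(i <- s) c i *: u i.
have w1 : 0 < 1 + `|w| by rewrite ltr_pwDl.
pose d3 := d2 / (1 + `|c i|).
have d3c : d3 * (1 + `|c i|) = d2 by rewrite divfK// gt_eqF.
have d30 : 0 < d3 by rewrite divr_gt0.
pose d4 := d2 / (1 + `|w|).
have d4c : d4 * (1 + `|w|) = d2 by rewrite divfK// gt_eqF.
have d40 : 0 < d4 by rewrite divr_gt0.
exists (Num.min d1 (Num.min d3 d4)); first by rewrite !lt_min d10 d30.
move=> y t; rewrite !lt_min => /and3P[yx1 yx3 yx4] /and3P[t1 t3 t4].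
rewrite !big_cons -/w.
have {}h1 := h1 y t yx1 t1.
have {}h2 : `|f ((t * c i) *: u i + (t *: w + y)) - f (t *: w + y) -
    t * c i * 'D_(u i) f x| <= e / 2 * `|t|.
  have := h2 (t *: w + y) (t * c i).
  rewrite -addrA normrM => h.
  apply: le_trans (h _ _) _.
  - rewrite (le_lt_trans (ler_normD _ _))// normrZ -d4c.
    have := normr_ge0 w; have := normr_ge0 t.
    by move: yx4 t4; move: `|y - x| `|w| `|t| => *; nra.
  - rewrite -d3c; have := normr_ge0 t; have := normr_ge0 (c i).
    by move: t3; move: `|t| `|c i| => *; nra.
  - rewrite mulrA mulrAC ler_wpM2r//.
    rewrite -mulrA ler_piMr ?(ltW e20)// mulrC ler_pdivrMr// mul1r.
    by rewrite lerDr.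
rewrite (_ : t *: (_ + w) + y = (t * c i) *: u i + (t *: w + y)); last first.
  by rewrite scalerDr scalerA addrA.
rewrite (_ : _ - _ = (f ((t * c i) *: u i + (t *: w + y)) - f (t *: w + y) -
    t * c i * 'D_(u i) f x) +
  (f (t *: w + y) - f y - t * (\sum_(i <- s) c i * 'D_(u i) f x))); last by ring.
rewrite (le_trans (ler_normD _ _))//.
by rewrite [e]splitr mulrDl lerD.
Qed.

Lemma is_derive_sum_dir (I : Type) (c : I -> R) (u : I -> V) f x (s : seq I) :
  (forall i, \forall y \near x, derivable f y (u i)) ->
  (forall i, {for x, continuous ('D_(u i) f)}) ->
  is_derive x (\sum_(i <- s) c i *: u i) f (\sum_(i <- s) c i * 'D_(u i) f x).
Proof.
move=> df cf; set w := \sum_(i <- s) _; set l := \sum_(i <- s) _.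
have : (fun h : R => h^-1 *: ((f \o shift x) (h *: w) - f x)) h @[h --> 0^'] --> l.
  apply/cvgrPdist_le => e e0.
  have [d d0 h] := derive_strict_sum c s df cf e0.
  exists d => //= t; rewrite /ball_/= sub0r normrN => td t0.
  have := h x t; rewrite subrr normr0 -/w -/l => /(_ d0 td) {}h.
  rewrite distrC.
  rewrite (_ : _ - l = t^-1 * (f (t *: w + x) - f x - t * l)); last first.
    by rewrite [RHS]mulrBr mulKf//.
  by rewrite normrM normfV ler_pdivrMl ?normr_gt0// [leRHS]mulrC.
move=> cl; apply: DeriveDef; first by apply/cvg_ex; exists l.
exact: cvg_lim.
Qed.

(* The second difference is symmetric in u and v, whence Schwarz's theorem. *)
Lemma second_difference f u v x :
  (\forall y \near x, derivable f y u) ->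
  (\forall y \near x, derivable ('D_u f) y v) ->
  {for x, continuous ('D_v ('D_u f))} -> forall e, 0 < e ->
  exists2 d : R, 0 < d & forall t, 0 < t < d ->
   `|f (t *: u + (t *: v + x)) - f (t *: u + x) - f (t *: v + x) + f x -
     t ^+ 2 * 'D_v ('D_u f) x| <= e * t ^+ 2.
Proof.
move=> /near_ballP[d1 d10 df] ddf cf e e0.
have [d2 d20 h] := derive_strict ddf cf e0.
pose m := Num.min d1 d2; have m0 : 0 < m by rewrite lt_min d10.
pose A := 1 + `|u| + `|v|.
have A0 : 0 < A by rewrite ltr_pwDl// ltr_pwDl.
pose d := m / A.
have d0 : 0 < d by rewrite divr_gt0.
have dm : d * A = m by rewrite divfK// gt_eqF.
exists d => // t /andP[t0 td].
have in_ball (a b : R) : `|a| <= t -> `|b| <= t -> `|a *: u + (b *: v + x) - x| < m.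
  move=> at_ bt; rewrite addrA addrK (le_lt_trans (ler_normD _ _))// !normrZ -dm /A.
  have := normr_ge0 u; have := normr_ge0 v.
  have := normr_ge0 a; have := normr_ge0 b.
  by move: at_ bt; move: `|u| `|v| `|a| `|b| => *; nra.
have tt : `|t| <= t by rewrite gtr0_norm.
have z0 : `|0 : R| <= t by rewrite normr0 ltW.
have deriv (b s : R) : `|b| <= t -> `|s| <= `|t| ->
    is_derive s 1 (fun s : R => f (s *: u + (b *: v + x)))
      ('D_u f (s *: u + (b *: v + x))).
  move=> bt st; apply/is_derive_line/df.
  rewrite (lt_le_trans (in_ball _ _ _ bt))//; first by rewrite (le_trans st).
  by rewrite ge_min lexx.
have [s st|c ct] := @MVT0
  (fun s => f (s *: u + (t *: v + x)) - f (s *: u + (0 *: v + x)))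
  (fun s => 'D_u f (s *: u + (t *: v + x)) - 'D_u f (s *: u + (0 *: v + x))) t.
  by apply: is_deriveB; exact: deriv.
rewrite !scale0r !add0r => E.
have -> : f (t *: u + (t *: v + x)) - f (t *: u + x) - f (t *: v + x) + f x =
  f (t *: u + (t *: v + x)) - f (t *: u + x) - (f (t *: v + x) - f x) by ring.
rewrite E.
have := h (c *: u + x) t _ _.
rewrite (gtr0_norm t0) addrCA => {}h.
rewrite (_ : _ - _ = t * ('D_u f (c *: u + (t *: v + x)) - 'D_u f (c *: u + x) -
    t * 'D_v ('D_u f) x)); last by ring.
rewrite normrM (gtr0_norm t0) expr2 mulrA [e * t * t]mulrC ler_pM2l//; apply: h.
  have := @in_ball c 0; rewrite scale0r add0r => /(_ _ z0) hh.
  rewrite (lt_le_trans (hh _))//; first by rewrite (le_trans ct).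
  by rewrite ge_min lexx orbT.
have A1 : 1 <= A by rewrite /A -addrA lerDl addr_ge0.
have m2 : m <= d2 by rewrite ge_min lexx orbT.
by nra.
Qed.

Lemma derive_derive_comm f u v x :
  (\forall y \near x, derivable f y u) -> (\forall y \near x, derivable f y v) ->
  (\forall y \near x, derivable ('D_u f) y v) ->
  (\forall y \near x, derivable ('D_v f) y u) ->
  {for x, continuous ('D_v ('D_u f))} -> {for x, continuous ('D_u ('D_v f))} ->
  'D_v ('D_u f) x = 'D_u ('D_v f) x.
Proof.
move=> fu fv fuv fvu cuv cvu.
apply/eqP; rewrite -subr_eq0 -normr_le0; apply/ler_addgt0Pr => e e0; rewrite add0r.
have e20 : 0 < e / 2 by rewrite divr_gt0.
have [d1 d10 h1] := second_difference fu fuv cuv e20.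
have [d2 d20 h2] := second_difference fv fvu cvu e20.
pose m := Num.min d1 d2; have m0 : 0 < m by rewrite lt_min d10.
pose t := m / 2; have t0 : 0 < t by rewrite divr_gt0.
have tm : t < m by rewrite ltr_pdivrMr// ltr_pMr// ltr1n.
have {}h1 : _ := h1 t; have {}h2 := h2 t.
move: h1 h2; rewrite t0 /= !(lt_le_trans tm) ?ge_min ?lexx ?orbT//.
move=> /(_ isT) h1 /(_ isT) h2.
have t20 : 0 < t ^+ 2 by rewrite exprn_gt0.
rewrite -(ler_pM2l t20) -{1}(gtr0_norm t20) -normrM.
move: h1 h2; rewrite addrCA.
set F := f _; set a := f _; set b := f _; set c := f x; set D := 'D_v _ _.
set D' := 'D_u _ _ => h1 h2.
rewrite (_ : _ * (D - D') = (F - b - a + c - t ^+ 2 * D') - (F - a - b + c - t ^+ 2 * D)).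
  rewrite (le_trans (ler_normB _ _))// (le_trans (lerD h2 h1))//.
  by rewrite -mulrDl -splitr mulrC.
by ring.
Qed.

End calculus.

Lemma second_derivative_le0 (R : realType) (f f1 : R -> R) (l d : R) : 0 < d ->
  (forall t : R, `|t| < d -> is_derive t 1 f (f1 t)) -> is_derive (0 : R) 1 f1 l ->
  (forall t, `|t| < d -> f t + f (- t) <= 2 * f 0) -> l <= 0.
Proof.
move=> d0 df df1 fle; rewrite leNgt; apply/negP => l0.
have /cvgrPdist_lt/(_ _ l0) : (fun h : R => h^-1 *: ((f1 \o shift 0) (h *: 1) - f1 0)) h
    @[h --> 0^'] --> l.
  by have [dd <-] := df1; exact: dd.
case => e e0 /= he.
have slope h : h != 0 -> `|h| < e -> 0 < (f1 h - f1 0) / h.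
  move=> h0 hh; have := he h; rewrite /ball_/= sub0r normrN => /(_ hh h0).
  rewrite addr0 -[h *: 1]/(h * 1) mulr1 -[_ *: _]/(_ * _) mulrC.
  by move/ltr_normlP => [_]; lra.
pose t := Num.min d e / 2.
have m0 : 0 < Num.min d e by rewrite lt_min d0.
have t0 : 0 < t by rewrite divr_gt0.
have : t < Num.min d e by rewrite ltr_pdivrMr// ltr_pMr// ltr1n.
rewrite lt_min => /andP[td te].
have cont (a b : R) : - t <= a -> b <= t -> {within `[a, b], continuous f}.
  move=> ta bt; apply: derivable_within_continuous => s; rewrite in_itv/= => /andP[? ?].
  apply/ex_derive/df; rewrite (le_lt_trans _ td)// ler_norml.
  by apply/andP; split; lra.
have deriv (a b : R) : - t <= a -> b <= t -> forall s : R, s \in `]a, b[ ->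
    is_derive s 1 f (f1 s).
  move=> ta bt s; rewrite in_itv/= => /andP[? ?].
  apply/df; rewrite (le_lt_trans _ td)// ler_norml.
  by apply/andP; split; lra.
have nt : - t <= 0 by rewrite oppr_le0 ltW.
have [c + Ec] := MVT t0 (deriv _ _ nt (lexx t)) (cont _ _ nt (lexx t)).
have nt0 : - t < 0 by lra.
have [c' + Ec'] := MVT nt0 (deriv _ _ (lexx _) (ltW t0)) (cont _ _ (lexx _) (ltW t0)).
rewrite !in_itv/= => /andP[c'1 c'2] /andP[c1 c2].
have := fle t; rewrite (gtr0_norm t0) => /(_ td).
have : f1 0 < f1 c.
  have : 0 < (f1 c - f1 0) / c.
    by apply: slope; rewrite ?gt_eqF// gtr0_norm// (lt_trans c2).
  by rewrite pmulr_lgt0 ?invr_gt0// subr_gt0.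
have : f1 c' < f1 0.
  have : 0 < (f1 c' - f1 0) / c'.
    by apply: slope; rewrite ?lt_eqF// ltr0_norm//; lra.
  by rewrite nmulr_lgt0 ?invr_lt0// subr_lt0.
by nra.
Qed.

(** * Test functions of class C^2 *)

Section viscosity_facts.
Variables (R : realType) (n : nat).
Implicit Types (x y v : 'rV[R]_n) (psi : 'rV[R]_n -> R).

Section C2.
Variables (Omega : set 'rV[R]_n) (psi : 'rV[R]_n -> R).
Hypotheses (oO : open Omega) (C2 : C2_on Omega psi).

Lemma C2_is_derive x v : Omega x ->
  is_derive x v psi (\sum_i v 0 i * partial i psi x).
Proof.
move=> Ox; rewrite {1}(row_sum_delta v); apply: is_derive_sum_dir => i.
  have : \forall y \near x, Omega y by exact: open_nbhs_nbhs.
  by apply: filterS => y /C2[_ /(_ i)[]].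
by have [_ /(_ i)[]] := C2 Ox.
Qed.

Lemma C2_is_derive_partial x v i : Omega x ->
  is_derive x v (partial i psi) (\sum_j v 0 j * partial j (partial i psi) x).
Proof.
move=> Ox; rewrite {1}(row_sum_delta v); apply: is_derive_sum_dir => j.
  have : \forall y \near x, Omega y by exact: open_nbhs_nbhs.
  by apply: filterS => y /C2[_ /(_ i)[_ _ /(_ j)[]]].
by have [_ /(_ i)[_ _ /(_ j)[]]] := C2 Ox.
Qed.

Lemma hessian_sym x : Omega x -> (hessian psi x)^T = hessian psi x.
Proof.
move=> Ox; apply/matrixP => i j; rewrite !mxE.
have nO : \forall y \near x, Omega y by exact: open_nbhs_nbhs.
apply: derive_derive_comm.
- by apply: filterS nO => y /C2[_ /(_ j)[]].
- by apply: filterS nO => y /C2[_ /(_ i)[]].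
- by apply: filterS nO => y /C2[_ /(_ j)[_ _ /(_ i)[]]].
- by apply: filterS nO => y /C2[_ /(_ i)[_ _ /(_ j)[]]].
- by have [_ /(_ j)[_ _ /(_ i)[]]] := C2 Ox.
- by have [_ /(_ i)[_ _ /(_ j)[]]] := C2 Ox.
Qed.

Lemma near_line x v (P : set 'rV[R]_n) : (\forall y \near x, P y) ->
  exists2 d : R, 0 < d & forall t, `|t| < d -> P (t *: v + x).
Proof.
move=> /near_ballP[d d0 dP]; have v1 : 0 < 1 + `|v| by rewrite ltr_pwDl.
exists (d / (1 + `|v|)); first by rewrite divr_gt0.
move=> t; rewrite ltr_pdivlMr// => td; apply: dP; rewrite addrK normrZ.
by rewrite (le_lt_trans _ td)// ler_wpM2l// lerDr.
Qed.

(* In the application, A cos (k t) bounds the mean of a supersolution at x + t v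
   and x - t v. *)
Lemma bform_hessian_le x v (A k : R) : Omega x ->
  (exists2 d : R, 0 < d & forall t, `|t| < d ->
    psi (t *: v + x) + psi (- t *: v + x) - 2 * A * cos (k * t) <=
    2 * psi x - 2 * A) ->
  bform (hessian psi x) v v <= - A * k ^+ 2.
Proof.
move=> Ox [d1 d10 h].
have [d2 d20 O2] := near_line v (open_nbhs_nbhs (conj oO Ox)).
pose f t := psi (t *: v + x) - A * cos (k * t).
pose f1 t := \sum_i v 0 i * partial i psi (t *: v + x) + A * k * sin (k * t).
suff : bform (hessian psi x) v v + A * k ^+ 2 <= 0 by lra.
apply: (@second_derivative_le0 _ f f1 _ (Num.min d1 d2)).
- by rewrite lt_min d10.
- move=> t; rewrite lt_min => /andP[t1 t2].
  have D := C2_is_derive v (O2 t t2).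
  have L := is_derive_line (@ex_derive _ _ _ _ _ _ _ D).
  rewrite (@derive_val _ _ _ _ _ _ _ D) in L.
  have C : is_derive t 1 (fun t => A * cos (k * t)) (A * (- sin (k * t) * k)).
    by apply: is_derive_eq; rewrite /GRing.scale/=; ring.
  rewrite (_ : f1 t = \sum_i v 0 i * partial i psi (t *: v + x) -
    A * (- sin (k * t) * k)); last by rewrite /f1; ring.
  exact: is_deriveB.
- have L i : is_derive (0 : R) 1 (fun t : R => v 0 i * partial i psi (t *: v + x))
      (v 0 i * \sum_j v 0 j * partial j (partial i psi) x).
    have Ox0 : Omega (0 *: v + x) by rewrite scale0r add0r.
    have D := C2_is_derive_partial v i Ox0.
    have L := is_derive_line (@ex_derive _ _ _ _ _ _ _ D).
    rewrite (@derive_val _ _ _ _ _ _ _ D) scale0r add0r in L.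
    exact: is_deriveZ.
  have C : is_derive (0 : R) 1 (fun t => A * k * sin (k * t)) (A * k ^+ 2).
    by apply: is_derive_eq; rewrite mulr0 cos0 /GRing.scale/=; ring.
  rewrite bformE.
  rewrite (_ : \sum_i _ = \sum_i v 0 i * \sum_j v 0 j * partial j (partial i psi) x);
    last first.
    apply: eq_bigr => i _; rewrite mulr_sumr; apply: eq_bigr => j _.
    by rewrite mxE mulrA.
  rewrite (_ : f1 = (\sum_i (fun t : R => v 0 i * partial i psi (t *: v + x))) +
    (fun t => A * k * sin (k * t))); last first.
    by apply/funext => t; rewrite /f1 /= fctE fct_sumE.
  apply: is_deriveD.
move=> t; rewrite lt_min => /andP[t1 t2].
have := h t t1; rewrite /f mulr0 cos0 scale0r add0r mulrN cosN; lra.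
Qed.
End C2.
End viscosity_facts.

(** * Extrema of lower semicontinuous quotients *)

Lemma exists_max_seq (T : eqType) (R : realType) (F : T -> R) (s : seq T) :
  s != [::] -> exists2 m, m \in s & forall y, y \in s -> F y <= F m.
Proof.
elim: s => // x [_ _|z s IH _].
  by exists x; rewrite ?mem_head// => y; rewrite inE => /eqP ->.
have [//|m ms mmax] := IH; have [mx|xm] := leP (F m) (F x).
  exists x; rewrite ?mem_head// => y; rewrite inE => /predU1P[->//|/mmax ym].
  exact: le_trans mx.
exists m; first by rewrite inE ms orbT.
by move=> y; rewrite inE => /predU1P[->|/mmax//]; exact: ltW.
Qed.

Section lsc_compact.
Variables (R : realType) (n : nat) (Omega : set 'rV[R]_n) (phi : 'rV[R]_n -> R).
Hypotheses (oO : open Omega) (lphi : lsc_on Omega phi).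

Lemma lsc_on_near x a : Omega x -> a < phi x -> \forall y \near x, a < phi y.
Proof.
move=> Ox ax; have [|V] := lphi (x := x) (a := a); first by rewrite lte_fin.
rewrite -[nbhs _]/(nbhs_subspace x) -nbhs_subspace_in// => VO Va.
have nO : \forall y \near x, Omega y by exact: open_nbhs_nbhs.
have : \forall y \near x, Omega y -> V y by exact: VO.
by apply: filterS2 nO => y Oy /(_ Oy) /Va; rewrite lte_fin.
Qed.

Lemma compact_max_ratio (T : set 'rV[R]_n) (h : 'rV[R]_n -> R) z :
  compact T -> T `<=` Omega -> (forall x, Omega x -> 0 < phi x) -> continuous h ->
  (forall x, T x -> 0 <= h x) -> T z -> 0 < h z ->
  exists x, [/\ T x, 0 < h x & forall y, T y -> h y * phi x <= h x * phi y].
Proof.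
move=> cT TO phi0 ch h0 Tz hz; apply: contrapT => nmax.
pose D := [set y | T y /\ 0 < h y].
pose U y := [set x | Omega x /\ h x * phi y < h y * phi x].
have openU y : D y -> open (U y).
  move=> [Ty hy]; rewrite openE => x [Ox xy] /=.
  have py := phi0 _ (TO _ Ty).
  pose m := (phi x + h x * phi y / h y) / 2.
  have hlt : h x * phi y / h y < phi x by rewrite ltr_pdivrMr// [_ * h y]mulrC.
  have nO : \forall y \near x, Omega y by exact: open_nbhs_nbhs.
  have m1 : \forall w \near x, m < phi w by apply: lsc_on_near => //; rewrite /m; lra.
  have m2 : \forall w \near x, h w < m * h y / phi y.
    apply: (cvgr_lt _ (ch x)); rewrite ltr_pdivlMr// -ltr_pdivrMr//.
    by rewrite /m; lra.
  near=> w; split; first by near: w.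
  have w1 : m < phi w by near: w.
  have : h w < m * h y / phi y by near: w.
  rewrite ltr_pdivlMr// => /lt_trans; apply.
  by rewrite mulrC ltr_pM2l.
have cover : T `<=` \bigcup_(y in D) U y.
  move=> x Tx; apply: contrapT => nU; apply: nmax.
  have xmax y : T y -> h y * phi x <= h x * phi y.
    move=> Ty; rewrite leNgt; apply/negP => lt; apply: nU; exists y.
      split=> //; have := h0 _ Tx; have := phi0 _ (TO _ Tx).
      have := phi0 _ (TO _ Ty) => p1 p2 p3.
      rewrite -(pmulr_lgt0 _ p2); apply: le_lt_trans lt.
      by rewrite mulr_ge0// ltW.
    by split=> //; exact: TO.
  exists x; split => //; have := xmax _ Tz.
  have := h0 _ Tx; rewrite le_eqVlt => /predU1P[<-|//].
  by rewrite mul0r leNgt mulr_gt0// phi0//; exact: TO.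
move: cT; rewrite compact_cover => /(_ _ D U openU cover)[D' D'D D'cover].
have [x xD' _] := D'cover _ Tz.
have D'0 : finmap.enum_fset D' != [::].
  by apply/eqP => D'0; have : x \in finmap.enum_fset D' := xD'; rewrite D'0.
have [m mD' mmax] := exists_max_seq (fun y => h y / phi y) D'0.
have /set_mem[Tm hm] := D'D _ mD'.
have [y yD' [_ lt]] := D'cover _ Tm.
have /set_mem[Ty hy] := D'D _ yD'.
have := mmax y yD'; rewrite leNgt => /negP; apply.
rewrite ltr_pdivrMr ?phi0//; last exact: TO.
by rewrite mulrAC ltr_pdivlMr ?phi0//; exact: TO.
Unshelve. all: by end_near. Qed.
End lsc_compact.

(** * Convexity of the cosine of a square root *)

Section cosine.
Variable R : realType.
Implicit Types a b p s t u v : R.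

Lemma MVT_le (g dg : R -> R) a b : a <= b ->
  (forall s : R, is_derive s 1 g (dg s)) ->
  exists2 c, a <= c <= b & g b - g a = dg c * (b - a).
Proof.
move=> ab dgP.
have cg : {within `[a, b], continuous g}.
  by apply: derivable_within_continuous => s _; have [] := dgP s.
have [c] := MVT_segment ab (fun s _ => dgP s) cg.
by rewrite in_itv => cab ->; exists c.
Qed.

Lemma cos_le s t : 0 <= s -> s <= t -> t <= pi -> cos t <= cos s.
Proof.
move=> s0 st tpi; have [->//|st'] := eqVneq s t.
have {st'} : s < t by rewrite lt_neqAle st' st.
by move=> h; rewrite ltW// ltr_cos// in_itv/=; apply/andP; split; lra.
Qed.

Lemma sin_chord s t : 0 <= s -> s <= t -> t <= pi -> s * sin t <= t * sin s.
Proof.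
move=> s0 st tpi.
have [c /andP[c0 cs]] := MVT_le s0 (@is_derive_sin R).
have [c' /andP[sc' c't]] := MVT_le st (@is_derive_sin R).
rewrite sin0 !subr0 => h1 h2.
have cc : cos c' <= cos c by apply: cos_le; lra.
have : s * (t - s) * cos c' <= s * (t - s) * cos c.
  by rewrite ler_wpM2l// mulr_ge0// subr_ge0.
by nra.
Qed.

(* Convexity of [s |-> cos (sqrt s)]: [cos s + k s^2] with [k = sin u / (2 u)]
   decreases on [0, u] and increases on [u, pi]. *)
Lemma cos_add_le a b u v : 0 <= a -> a <= u -> u <= v -> v <= b -> b <= pi ->
  u ^+ 2 + v ^+ 2 = a ^+ 2 + b ^+ 2 -> cos u + cos v <= cos a + cos b.
Proof.
move=> a0 au uv vb bpi E.
have [u0|u0] := eqVneq u 0.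
  have a0' : a = 0 by lra.
  have -> : v = b.
    apply/eqP; rewrite -(@eqrXn2 _ 2)//; try lra.
    by apply/eqP; move: E; rewrite u0 a0'; lra.
  by rewrite u0 a0'.
have {}u0 : 0 < u by rewrite lt_neqAle eq_sym u0 (le_trans a0).
pose k := sin u / (2 * u).
have ku : sin u = 2 * k * u by rewrite /k; field; rewrite gt_eqF.
pose g s := cos s + k * s ^+ 2.
have dg s : is_derive s 1 g (- sin s + 2 * k * s).
  apply: is_derive_eq; rewrite -[s%:A]/(s * 1) -[_ *: _]/(_ * _).
  by ring.
have [c /andP[ac cu] Ec] := MVT_le au dg.
have [c' /andP[vc' c'b] Ec'] := MVT_le vb dg.
have h1 : sin c' <= 2 * k * c'.
  rewrite -(ler_pM2l u0) (_ : u * (2 * k * c') = c' * sin u); last first.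
    by rewrite ku; ring.
  by apply: sin_chord; lra.
have h2 : 2 * k * c <= sin c.
  rewrite -(ler_pM2l u0) (_ : u * (2 * k * c) = c * sin u); last first.
    by rewrite ku; ring.
  by apply: sin_chord; lra.
have Gu : g u <= g a.
  rewrite -subr_le0 Ec mulr_le0_ge0 ?subr_ge0//; lra.
have Gv : g v <= g b.
  rewrite -subr_ge0 Ec' mulr_ge0 ?subr_ge0//; lra.
have : k * (u ^+ 2 + v ^+ 2) = k * (a ^+ 2 + b ^+ 2) by rewrite E.
by move: Gu Gv; rewrite /g; lra.
Qed.

Lemma cos_sqrt_le p t d : 0 <= p -> 0 <= t -> p + t <= pi -> `|d| <= p * t ->
  cos (Num.sqrt (p ^+ 2 + t ^+ 2 + 2 * d)) +
  cos (Num.sqrt (p ^+ 2 + t ^+ 2 - 2 * d)) <= 2 * cos p * cos t.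
Proof.
move=> p0 t0 ptpi.
wlog d0 : d / 0 <= d.
  move=> H dpt; have [d0|d0] := leP 0 d; first exact: H.
  have := H (- d); rewrite normrN mulrN opprK addrC; apply => //; lra.
rewrite ger0_norm// => dpt.
have -> : 2 * cos p * cos t = cos `|p - t| + cos (p + t).
  have -> : cos `|p - t| = cos (p - t).
    by have [h|h] := leP 0 (p - t); [rewrite ger0_norm|rewrite ltr0_norm// cosN].
  by rewrite cosB cosD; lra.
have h1 : (p - t) ^+ 2 <= p ^+ 2 + t ^+ 2 - 2 * d by lra.
have h2 : p ^+ 2 + t ^+ 2 - 2 * d <= p ^+ 2 + t ^+ 2 + 2 * d by lra.
have h3 : p ^+ 2 + t ^+ 2 + 2 * d <= (p + t) ^+ 2 by lra.
have h0 := sqr_ge0 (p - t).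
have h4 := le_trans h0 h1; have h5 := le_trans h4 h2; have h6 := le_trans h5 h3.
rewrite addrC; apply: cos_add_le => //.
- by rewrite -sqrtr_sqr ler_sqrt.
- by rewrite ler_sqrt.
- by rewrite -[leRHS]ger0_norm ?addr_ge0// -sqrtr_sqr ler_sqrt.
- by rewrite !sqr_sqrtr// real_normK ?num_real//; lra.
Qed.

End cosine.

(** * Lower bound for the ball *)

Section euclidean_norm.
Variables (R : realType) (n : nat).
Implicit Types (x y v : 'rV[R]_n).

Definition enorm x : R := Num.sqrt (bform 1%:M x x).

Lemma enorm_ge0 x : 0 <= enorm x. Proof. exact: sqrtr_ge0. Qed.

Lemma sqr_enorm x : enorm x ^+ 2 = bform 1%:M x x.
Proof. by rewrite sqr_sqrtr// bform1_ge0. Qed.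

Lemma enorm_cauchy_schwarz x y : `|bform 1%:M x y| <= enorm x * enorm y.
Proof.
rewrite -ler_sqr ?nnegrE ?mulr_ge0 ?enorm_ge0// exprMn !sqr_enorm.
rewrite real_normK ?num_real//.
set A := bform _ x x; set B := bform _ x y; set C := bform _ y y.
have [C0|C0] := eqVneq C 0.
  by rewrite /B C0 mulr0 (bform1_eq0 C0) -(scale0r 0) bformZr mul0r expr0n.
have {}C0 : 0 < C by rewrite lt0r C0 bform1_ge0.
have := bform1_ge0 (C *: x + (- B) *: y).
rewrite !(bformDl, bformDr, bformZl, bformZr) (bformC y x (trmx1 _ _)).
rewrite -/A -/B -/C => h.
have : 0 <= C * (A * C - B ^+ 2) by lra.
by rewrite pmulr_rge0// subr_ge0.
Qed.

Lemma continuous_enorm : continuous enorm.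
Proof.
move=> x; apply: (@continuous_comp _ _ _ (fun v => bform 1%:M v v) Num.sqrt).
  exact: continuous_bform.
exact: sqrt_continuous.
Qed.

Lemma eball_enorm (rho : R) : eball n rho = [set x | enorm x < rho].
Proof. by apply/funext => x; rewrite /eball /enorm /= bform1E. Qed.

Lemma open_eball (rho : R) : open (eball n rho : set 'rV[R]_n).
Proof.
rewrite eball_enorm (_ : [set x | _] = enorm @^-1` [set t | t < rho])//.
apply: open_comp; last exact: open_lt.
by move=> x _; exact: continuous_enorm.
Qed.

Lemma continuous_lsc_on (Omega : set 'rV[R]_n) (phi : 'rV[R]_n -> R) :
  continuous phi -> lsc_on Omega phi.
Proof.
move=> cphi x a; rewrite lte_fin => ax.
exists [set y | a < phi y]; last by move=> y /=; rewrite lte_fin.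
have cx := @continuous_subspaceT _ _ Omega _ cphi x.
apply: (cx [set t | a < t]).
by apply: open_nbhs_nbhs; split => //; exact: open_gt.
Qed.

Lemma cos_enorm_second_difference x v (b t : R) : 0 <= b -> 
  b * enorm x + b * `|t| * enorm v <= pi ->
  cos (b * enorm (t *: v + x)) + cos (b * enorm (- t *: v + x)) <=
  2 * cos (b * enorm x) * cos (b * enorm v * t).
Proof.
move=> b0 hpi.
have bE s : b * enorm (s *: v + x) = Num.sqrt
    ((b * enorm x) ^+ 2 + (b * `|s| * enorm v) ^+ 2 +
     2 * (s * b ^+ 2 * bform 1%:M x v)).
  rewrite -[b in LHS]ger0_norm// -sqrtr_sqr -sqrtrM ?sqr_ge0//; congr Num.sqrt.
  rewrite !(bformDl, bformDr, bformZl, bformZr) (bformC v x (trmx1 _ _)).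
  by rewrite !exprMn !sqr_enorm real_normK ?num_real//; ring.
have -> : cos (b * enorm v * t) = cos (b * `|t| * enorm v).
  have [t0|t0] := leP 0 t; first by rewrite ger0_norm// mulrAC.
  by rewrite ltr0_norm// mulrAC mulrN mulNr cosN.
rewrite !bE normrN.
rewrite (_ : 2 * (- t * _ * _) = - (2 * (t * b ^+ 2 * bform 1%:M x v))); last by ring.
apply: cos_sqrt_le => //; try by rewrite !mulr_ge0// enorm_ge0.
rewrite normrM [`|t * _|]normrM (ger0_norm (sqr_ge0 b)).
have := enorm_cauchy_schwarz x v; move: `|bform _ _ _| => c cxv.
rewrite (_ : b * enorm x * (b * `|t| * enorm v) =
  `|t| * b ^+ 2 * (enorm x * enorm v)); last by ring.
by rewrite ler_wpM2l// mulr_ge0// sqr_ge0.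
Qed.

Lemma mu1plus_eball_ge (rho : R) : (0 < n)%N -> 0 < rho ->
  (((pi / (2 * rho)) ^+ 2)%:E <= mu1plus (eball n rho : set 'rV[R]_n))%E.
Proof.
move=> n0 rho0; set b := pi / _.
have b0 : 0 < b by rewrite divr_gt0 ?pi_gt0 ?mulr_gt0.
have brho : b * rho = pi / 2 by rewrite /b; field; rewrite gt_eqF.
clearbody b.
apply: ereal_sup_ubound; exists (b ^+ 2) => //; exists (fun x => cos (b * enorm x)).
have pihalf x : eball n rho x -> b * enorm x < pi / 2.
  by rewrite eball_enorm /= -brho ltr_pM2l.
split.
- apply: continuous_lsc_on => x.
  apply: (@continuous_comp _ _ _ (fun x => b * enorm x)); last exact: continuous_cos.
  by apply: continuousM; [exact: cst_continuous|exact: continuous_enorm].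
- move=> x /pihalf xb; apply: cos_gt0_pihalf; rewrite xb andbT.
  rewrite (@lt_le_trans _ _ 0)//; first by rewrite oppr_lt0 divr_gt0 ?pi_gt0.
  by rewrite mulr_ge0 ?enorm_ge0// ltW.
move=> psi x C2 Ox touch.
have [/eigenvalueP[v vX v0] _] :=
  P1plus_max n0 (hessian_sym (@open_eball rho) C2 Ox).
set M := P1plus _ in vX *.
have v1 : 0 < bform 1%:M v v.
  rewrite lt0r bform1_ge0 andbT.
  by apply: contra_neq v0; exact: bform1_eq0.
have E : bform (hessian psi x) v v = M * bform 1%:M v v.
  by rewrite {1}/bform vX -scalemxAl mxE /bform mulmx1.
suff h : bform (hessian psi x) v v <= - cos (b * enorm x) * (b * enorm v) ^+ 2.
  rewrite -(ler_pM2r v1) mul0r mulrDl.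
  by move: h; rewrite E exprMn sqr_enorm; lra.
apply: (bform_hessian_le (@open_eball rho) C2 Ox).
have [d1 d10 h1] := near_line v touch.
have [d2 d20 h2] : exists2 d : R, 0 < d & forall t : R, `|t| < d ->
    b * enorm x + b * `|t| * enorm v <= pi.
  have ev : 0 < 1 + enorm v by rewrite ltr_pwDl// enorm_ge0.
  exists (pi / 2 / b / (1 + enorm v)); first by do 3![rewrite divr_gt0 ?pi_gt0//].
  move=> t; rewrite !ltr_pdivlMr// => td; have := pihalf _ Ox.
  have : b * `|t| * enorm v <= `|t| * (1 + enorm v) * b.
    rewrite (_ : _ * b = b * `|t| + b * `|t| * enorm v); last by ring.
    by rewrite lerDr mulr_ge0// ltW.
  by lra.
exists (Num.min d1 d2); first by rewrite lt_min d10.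
move=> t; rewrite lt_min => /andP[t1 t2].
have := h1 t t1; have := h1 (- t); rewrite normrN => /(_ t1).
have := cos_enorm_second_difference (ltW b0) (h2 t t2).
lra.
Qed.
End euclidean_norm.

(** * Upper bound for the cube *)

Lemma is_derive_of_line (R : realType) (V : normedModType R) (f : V -> R) v x (l : R) :
  is_derive (0 : R) 1 (fun t : R => f (t *: v + x)) l -> is_derive x v f l.
Proof.
have E : (fun h : R => h^-1 *: (((fun s : R => f (s *: v + x)) \o shift 0) (h *: 1) -
    f (0 *: v + x))) =
  (fun h : R => h^-1 *: ((f \o shift x) (h *: v) - f x)).
  apply/funext => h /=; rewrite -[h *: 1]/(h * 1) mulr1 addr0.
  by rewrite scale0r add0r.
move=> [df lE]; apply: DeriveDef; first by rewrite /derivable -E.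
by rewrite /derive -E.
Qed.

Lemma continuous_subr (T : topologicalType) (R : realType) (f g : T -> R) x :
  {for x, continuous f} -> {for x, continuous g} ->
  {for x, continuous (fun y => f y - g y)}.
Proof. by move=> cf cg; exact: cvgB cf cg. Qed.

Section tube_function.
Variables (R : realType) (n : nat).
Hypothesis n0 : (0 < n)%N.
Implicit Types (x y v w : 'rV[R]_n).

Let N0 : n%:R != 0 :> R. Proof. by rewrite pnatr_eq0 -lt0n. Qed.

Definition csum x : R := \sum_i x 0 i.

(* Inner product of the components orthogonal to the diagonal. *)
Definition odiag x y : R := bform 1%:M x y - csum x * csum y / n%:R.

Lemma csumD x y : csum (x + y) = csum x + csum y.
Proof. by rewrite /csum -big_split; apply: eq_bigr => i _; rewrite mxE. Qed.

Lemma csumZ a x : csum (a *: x) = a * csum x.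
Proof. by rewrite /csum mulr_sumr; apply: eq_bigr => i _; rewrite mxE. Qed.

Lemma odiagC x y : odiag x y = odiag y x.
Proof. by rewrite /odiag (bformC _ _ (trmx1 _ _)) [csum x * _]mulrC. Qed.

Lemma odiagDl x y v : odiag (x + y) v = odiag x v + odiag y v.
Proof. by rewrite /odiag bformDl csumD; ring. Qed.

Lemma odiagZl a x v : odiag (a *: x) v = a * odiag x v.
Proof. by rewrite /odiag bformZl csumZ; ring. Qed.

Lemma odiagDr x y v : odiag v (x + y) = odiag v x + odiag v y.
Proof. by rewrite !(odiagC v) odiagDl. Qed.

Lemma odiagZr a x v : odiag v (a *: x) = a * odiag v x.
Proof. by rewrite !(odiagC v) odiagZl. Qed.

Lemma bform1_const1 x : bform 1%:M x (const_mx 1) = csum x.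
Proof.
rewrite /bform mulmx1 mxE; apply: eq_bigr => i _.
by rewrite !mxE mulr1.
Qed.

Lemma csum_const1 : csum (const_mx 1) = n%:R.
Proof.
rewrite /csum; under eq_bigr do rewrite mxE.
by rewrite sumr_const card_ord.
Qed.

Lemma odiag_const1 x : odiag x (const_mx 1) = 0.
Proof. by rewrite /odiag bform1_const1 csum_const1 mulfK// subrr. Qed.

Lemma odiag_ge_coord x i : (x 0 i - csum x / n%:R) ^+ 2 <= odiag x x.
Proof.
have -> : odiag x x = bform 1%:M (x - (csum x / n%:R) *: const_mx 1)
    (x - (csum x / n%:R) *: const_mx 1).
  rewrite -scaleNr !(bformDl, bformDr, bformZl, bformZr).
  rewrite (bformC (const_mx 1) x (trmx1 _ _)) !bform1_const1 csum_const1.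
  by rewrite /odiag; field.
rewrite bform1E (bigD1 i)//= !mxE mulr1 lerDl sumr_ge0// => j _; exact: sqr_ge0.
Qed.

Lemma continuous_csum : continuous csum.
Proof. by move=> x; apply: continuous_sumr => i; exact: coord_continuous. Qed.

Lemma continuous_bform1 v : continuous (fun x => bform 1%:M x v).
Proof.
rewrite (_ : (fun x => _) = fun x => \sum_i x 0 i * v 0 i).
  move=> x; apply: continuous_sumr => i; apply: continuousM.
    exact: coord_continuous.
  exact: cst_continuous.
by apply/funext => y; rewrite /bform mulmx1 mxE; apply: eq_bigr => i _; rewrite mxE.
Qed.

Lemma continuous_odiag v : continuous (fun x => odiag x v).
Proof.
move=> x; apply: (@continuous_subr _ _ (fun x => bform 1%:M x v)
  (fun x => csum x * csum v / n%:R)); first exact: continuous_bform1.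
apply: continuousM; last exact: cst_continuous.
by apply: continuousM; [exact: continuous_csum|exact: cst_continuous].
Qed.

Lemma continuous_odiag_diag : continuous (fun x => odiag x x).
Proof.
move=> x; apply: (@continuous_subr _ _ (fun x => bform 1%:M x x)
  (fun x => csum x * csum x / n%:R)); first exact: continuous_bform.
apply: continuousM; last exact: cst_continuous.
by apply: continuousM; exact: continuous_csum.
Qed.

Variables (c a K : R).

Definition tube_fun x := c * cos (a * csum x) * (1 - K * odiag x x).

Definition tube_fun1 v x := c * (- (a * csum v) * sin (a * csum x) *
  (1 - K * odiag x x) - cos (a * csum x) * (2 * K * odiag x v)).

Definition tube_fun2 v w x := c * (
  - (a ^+ 2 * csum v * csum w) * cos (a * csum x) * (1 - K * odiag x x) +
  sin (a * csum x) * (2 * a * K) * (csum v * odiag x w + csum w * odiag x v) -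
  cos (a * csum x) * (2 * K * odiag w v)).

Lemma is_derive_tube_fun x v : is_derive x v tube_fun (tube_fun1 v x).
Proof.
apply: is_derive_of_line.
rewrite (_ : (fun t => _) = fun t : R => c * cos (a * (t * csum v + csum x)) *
  (1 - K * (odiag v v * t ^+ 2 + (2 * odiag x v) * t + odiag x x))); last first.
  apply/funext => t; rewrite /tube_fun csumD csumZ.
  rewrite !(odiagDl, odiagDr, odiagZl, odiagZr) (odiagC v x).
  by congr (_ * (1 - _ * _)); ring.
apply: is_derive_eq.
by rewrite /tube_fun1 /GRing.scale /= !mul0r !add0r; ring.
Qed.

Lemma is_derive_tube_fun1 x v w : is_derive x w (tube_fun1 v) (tube_fun2 v w x).
Proof.
apply: is_derive_of_line.
rewrite (_ : (fun t => _) = fun t : R => c * (- (a * csum v) *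
  sin (a * (t * csum w + csum x)) *
  (1 - K * (odiag w w * t ^+ 2 + (2 * odiag x w) * t + odiag x x)) -
  cos (a * (t * csum w + csum x)) * (2 * K * (t * odiag w v + odiag x v)))); last first.
  apply/funext => t; rewrite /tube_fun1 csumD csumZ.
  rewrite !(odiagDl, odiagDr, odiagZl, odiagZr) (odiagC w x).
  by congr (_ * (_ * (1 - _ * _) - _)); ring.
apply: is_derive_eq.
by rewrite /tube_fun2 /GRing.scale /= !mul0r !add0r; ring.
Qed.

Lemma continuous_norm_csum : continuous (fun x => `|a * csum x|).
Proof.
move=> x; apply: (@continuous_comp _ _ _ (fun x => a * csum x) Num.norm).
  by apply: continuousM; [exact: cst_continuous|exact: continuous_csum].
exact: norm_continuous.
Qed.

Lemma continuous_Zodiag_diag : continuous (fun x => K * odiag x x).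
Proof.
move=> x; apply: (@continuousM _ _ (cst K) (fun x => odiag x x)).
  exact: cst_continuous.
exact: continuous_odiag_diag.
Qed.

Lemma continuous_cos_csum : continuous (fun x => cos (a * csum x)).
Proof.
move=> x; apply: (@continuous_comp _ _ _ (fun x => a * csum x)).
  by apply: continuousM; [exact: cst_continuous|exact: continuous_csum].
exact: continuous_cos.
Qed.

Lemma continuous_sin_csum : continuous (fun x => sin (a * csum x)).
Proof.
move=> x; apply: (@continuous_comp _ _ _ (fun x => a * csum x)).
  by apply: continuousM; [exact: cst_continuous|exact: continuous_csum].
exact: continuous_sin.
Qed.

Lemma continuous_tube_cutoff : continuous (fun x => 1 - K * odiag x x).
Proof.
move=> x; apply: (@continuous_subr _ _ (cst 1) (fun x => K * odiag x x)).
  exact: cst_continuous.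
exact: continuous_Zodiag_diag.
Qed.

Lemma continuous_tube_fun : continuous tube_fun.
Proof.
move=> x; apply: (@continuousM _ _ (fun x => c * cos (a * csum x))
  (fun x => 1 - K * odiag x x)); last exact: continuous_tube_cutoff.
by apply: continuousM; [exact: cst_continuous|exact: continuous_cos_csum].
Qed.

Lemma continuous_tube_fun1 v : continuous (tube_fun1 v).
Proof.
move=> x; apply: (@continuousM _ _ (cst c)
  (fun x => - (a * csum v) * sin (a * csum x) * (1 - K * odiag x x) -
    cos (a * csum x) * (2 * K * odiag x v))); first exact: cst_continuous.
apply: (@continuous_subr _ _
  (fun x => - (a * csum v) * sin (a * csum x) * (1 - K * odiag x x))
  (fun x => cos (a * csum x) * (2 * K * odiag x v))).
  apply: (@continuousM _ _ (fun x => - (a * csum v) * sin (a * csum x))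
    (fun x => 1 - K * odiag x x)); last exact: continuous_tube_cutoff.
  by apply: continuousM; [exact: cst_continuous|exact: continuous_sin_csum].
apply: (@continuousM _ _ (fun x => cos (a * csum x)) (fun x => 2 * K * odiag x v)).
  exact: continuous_cos_csum.
by apply: continuousM; [exact: cst_continuous|exact: continuous_odiag].
Qed.

Lemma continuous_tube_fun2 v w : continuous (tube_fun2 v w).
Proof.
move=> x; apply: (@continuousM _ _ (cst c)
  (fun x => - (a ^+ 2 * csum v * csum w) * cos (a * csum x) * (1 - K * odiag x x) +
    sin (a * csum x) * (2 * a * K) * (csum v * odiag x w + csum w * odiag x v) -
    cos (a * csum x) * (2 * K * odiag w v))); first exact: cst_continuous.
apply: (@continuous_subr _ _
  (fun x => - (a ^+ 2 * csum v * csum w) * cos (a * csum x) * (1 - K * odiag x x) +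
    sin (a * csum x) * (2 * a * K) * (csum v * odiag x w + csum w * odiag x v))
  (fun x => cos (a * csum x) * (2 * K * odiag w v))); last first.
  by apply: continuousM; [exact: continuous_cos_csum|exact: cst_continuous].
apply: (@continuousD _ _ _
  (fun x => - (a ^+ 2 * csum v * csum w) * cos (a * csum x) * (1 - K * odiag x x))
  (fun x => sin (a * csum x) * (2 * a * K) *
    (csum v * odiag x w + csum w * odiag x v))).
  apply: (@continuousM _ _ (fun x => - (a ^+ 2 * csum v * csum w) * cos (a * csum x))
    (fun x => 1 - K * odiag x x)); last exact: continuous_tube_cutoff.
  by apply: continuousM; [exact: cst_continuous|exact: continuous_cos_csum].
apply: (@continuousM _ _ (fun x => sin (a * csum x) * (2 * a * K))
  (fun x => csum v * odiag x w + csum w * odiag x v)).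
  by apply: continuousM; [exact: continuous_sin_csum|exact: cst_continuous].
apply: (@continuousD _ _ _ (fun x => csum v * odiag x w) (fun x => csum w * odiag x v));
  by apply: continuousM; [exact: cst_continuous|exact: continuous_odiag].
Qed.

Lemma partial_tube_fun i : partial i tube_fun = tube_fun1 (delta_mx 0 i).
Proof. by apply/funext => x; have [] := is_derive_tube_fun x (delta_mx 0 i). Qed.

Lemma partial_tube_fun1 i v : partial i (tube_fun1 v) = tube_fun2 v (delta_mx 0 i).
Proof. by apply/funext => x; have [] := is_derive_tube_fun1 x v (delta_mx 0 i). Qed.

Lemma C2_tube_fun Omega : C2_on Omega tube_fun.
Proof.
move=> x _; split; first exact: continuous_tube_fun.
move=> i; rewrite partial_tube_fun; split.
- by have [] := is_derive_tube_fun x (delta_mx 0 i).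
- exact: continuous_tube_fun1.
- move=> j; rewrite partial_tube_fun1; split; last exact: continuous_tube_fun2.
  by have [] := is_derive_tube_fun1 x (delta_mx 0 i) (delta_mx 0 j).
Qed.

Lemma csum_delta i : csum (delta_mx 0 i) = 1.
Proof.
rewrite /csum (bigD1 i)//= mxE !eqxx big1 ?addr0// => j /negPf ji.
by rewrite mxE ji.
Qed.

Lemma sum_odiag_delta x : \sum_i odiag x (delta_mx 0 i) = 0.
Proof.
under eq_bigr => i _ do rewrite /odiag csum_delta mulr1.
rewrite sumrB sumr_const card_ord -[X in _ - X]mulr_natr divfK//.
rewrite (_ : \sum_i _ = csum x) ?subrr//; apply: eq_bigr => i _.
by rewrite /bform mulmx1 trmx_delta -colE mxE.
Qed.

Lemma bform_hessian_tube_fun x :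
  bform (hessian tube_fun x) (const_mx 1) (const_mx 1) =
  - (a ^+ 2 * n%:R ^+ 2) * tube_fun x.
Proof.
pose one : 'rV[R]_n := const_mx 1.
have E i : \sum_j one 0 i * one 0 j * hessian tube_fun x i j =
    tube_fun2 (delta_mx 0 i) (const_mx 1) x.
  have [_ <-] := is_derive_tube_fun1 x (delta_mx 0 i) (const_mx 1).
  rewrite -partial_tube_fun.
  have [_ ->] := C2_is_derive_partial openT (@C2_tube_fun setT) (const_mx 1) i
    (I : setT x).
  by apply: eq_bigr => j _; rewrite !mxE mul1r.
rewrite bformE (eq_bigr _ (fun i _ => E i)).
pose A := - (a ^+ 2 * n%:R) * tube_fun x.
pose B := c * sin (a * csum x) * (2 * a * K) * n%:R.
rewrite (eq_bigr (fun i => A + B * odiag x (delta_mx 0 i))) => [|i _].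
  rewrite big_split/= -[X in _ + X]mulr_sumr sum_odiag_delta.
  rewrite sumr_const card_ord -[X in X + _]mulr_natr /A.
  by ring.
rewrite /tube_fun2 odiag_const1 (odiagC (const_mx 1)) odiag_const1 csum_const1.
by rewrite csum_delta /A /B /tube_fun; ring.
Qed.

End tube_function.

Section cube.
Variables (R : realType) (n : nat).
Implicit Types (x y : 'rV[R]_n).

Lemma open_cube (r : R) : 0 < r -> open (cube n r : set 'rV[R]_n).
Proof.
move=> r0; rewrite (_ : cube n r = ball (0 : 'rV[R]_n) r); first exact: ball_open.
apply/seteqP; split => [x xr|x [_ xr] i].
  by split=> // i j; rewrite /ball/= mxE sub0r normrN ord1 ltr_norml; exact: xr.
by have := xr 0 i; rewrite /ball/= mxE sub0r normrN ltr_norml.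
Qed.

Lemma supersolution_cube_le (r a mu : R) (phi : 'rV[R]_n -> R) :
  (0 < n)%N -> 0 < r -> 0 < a -> pi / 2 < a * r * n%:R ->
  lsc_on (cube n r) phi -> (forall x, cube n r x -> 0 < phi x) ->
  visc_supersol (cube n r) mu phi -> mu <= a ^+ 2 * n%:R.
Proof.
move=> n0 r0 a0 ar lphi phi0 sphi.
have N0 : 0 < n%:R :> R by rewrite ltr0n.
pose l := pi / 2 / (a * n%:R).
have an0 : 0 < a * n%:R by rewrite mulr_gt0.
have lr : l < r by rewrite /l ltr_pdivrMr// mulrCA mulrA.
have la : l * (a * n%:R) = pi / 2 by rewrite divfK// gt_eqF.
pose m := (r - l) / 2; have m0 : 0 < m by rewrite divr_gt0// subr_gt0.
pose K := (m ^+ 2)^-1; have K0 : 0 < K by rewrite invr_gt0 exprn_gt0.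
pose h := @tube_fun R n 1 a K.
pose T := [set x : 'rV[R]_n | `|a * csum x| <= pi / 2 /\ K * odiag x x <= 1].
have TC : T `<=` cube n r.
  move=> x [xs xK] i.
  have : (x 0 i - csum x / n%:R) ^+ 2 <= m ^+ 2.
    rewrite (le_trans (odiag_ge_coord n0 _ _))//.
    by move: xK; rewrite /K ler_pdivrMl ?exprn_gt0// mulr1.
  rewrite -ler_sqrt ?sqr_ge0// !sqrtr_sqr (gtr0_norm m0) ler_norml => /andP[x1 x2].
  have : `|csum x / n%:R| <= l.
    rewrite -(ler_pM2r an0) la -{1}(gtr0_norm an0) -normrM.
    by rewrite (_ : _ * (a * _) = a * csum x)//; field; rewrite gt_eqF.
  rewrite ler_norml => /andP[s1 s2]; apply/andP.
  by move: x1 x2; rewrite /m; split; lra.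
have closedT : closed T.
  rewrite (_ : T = (fun x => `|a * csum x|) @^-1` [set t | t <= pi / 2] `&`
    (fun x => K * odiag x x) @^-1` [set t | t <= 1])//.
  apply: closedI; apply: preimage_closed; try exact: closed_le.
    by move=> x _; exact: continuous_norm_csum.
  by move=> x _; exact: continuous_Zodiag_diag.
have compactT : compact T.
  have cI : compact [set v : 'rV[R]_n | forall i, `[- r, r]%classic (v ord0 i)].
    apply: (@rV_compact R n (fun=> `[- r, r]%classic)) => _.
    exact: segment_compact.
  apply: subclosed_compact cI _ => //.
  by move=> x /TC xC i; have /andP[? ?] := xC i; rewrite /= in_itv/= !ltW.
have h_ge0 x : T x -> 0 <= h x.
  move=> [xs xK]; rewrite /h /tube_fun mul1r mulr_ge0 ?subr_ge0//.
  by apply: cos_ge0_pihalf; rewrite -ler_norml.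
have c0 : csum (0 : 'rV[R]_n) = 0 by rewrite -(scale0r 0) csumZ mul0r.
have o0 : odiag (0 : 'rV[R]_n) 0 = 0 by rewrite -(scale0r 0) odiagZl mul0r.
have T0 : T 0.
  by split; rewrite ?c0 ?o0 !mulr0 ?ler01// normr0 divr_ge0// pi_ge0.
have h0 : 0 < h 0 by rewrite /h /tube_fun c0 o0 !mulr0 cos0 subr0 !mulr1.
have [x [Tx hx xmax]] := compact_max_ratio (open_cube r0) lphi compactT TC phi0
  (@continuous_tube_fun _ _ _ _ _) h_ge0 T0 h0.
have Cx := TC _ Tx; have px := phi0 _ Cx.
pose c := phi x / h x; have cpos : 0 < c by rewrite divr_gt0.
pose psi := @tube_fun R n c a K.
have psiE y : psi y = c * h y by rewrite /psi /h /tube_fun; ring.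
have psix : psi x = phi x by rewrite psiE /c divfK// gt_eqF.
have nT : \forall y \near x, T y.
  have [xs xK] := Tx.
  have cosx : cos (a * csum x) != 0.
    by apply: contraTneq hx; rewrite /h /tube_fun => ->; rewrite mulr0 mul0r ltxx.
  have kx : 1 - K * odiag x x != 0.
    by apply: contraTneq hx; rewrite /h /tube_fun => ->; rewrite mulr0 ltxx.
  have {}xs : `|a * csum x| < pi / 2.
    rewrite lt_neqAle xs andbT; apply: contra_neq cosx => E.
    have <- : cos `|a * csum x| = cos (a * csum x).
      by have [t0|t0] := leP 0 (a * csum x);
        [rewrite ger0_norm|rewrite ltr0_norm// cosN].
    by rewrite E cos_pihalf.
  have {}xK : K * odiag x x < 1.
    by rewrite lt_neqAle xK andbT; apply: contra_neq kx => ->; rewrite subrr.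
  have n1 : \forall y \near x, `|a * csum y| < pi / 2.
    by apply: (cvgr_lt _ (@continuous_norm_csum R n a x)).
  have n2 : \forall y \near x, K * odiag y y < 1.
    by apply: (cvgr_lt _ (@continuous_Zodiag_diag R n K x)).
  by apply: filterS2 n1 n2 => y y1 y2; split; exact: ltW.
have := sphi psi x (@C2_tube_fun R n c a K _) Cx.
have touch : \forall y \near x, phi x - psi x <= phi y - psi y.
  apply: filterS nT => y Ty; rewrite psix subrr subr_ge0 psiE /c.
  by rewrite mulrAC ler_pdivrMr// mulrC [leRHS]mulrC xmax.
move=> /(_ touch).
have [_ /(_ (const_mx 1))] := P1plus_max n0
  (hessian_sym openT (@C2_tube_fun R n c a K setT) (I : setT x)).
rewrite bform_hessian_tube_fun// bform1_const1 csum_const1 -/psi psix => h1 h2.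
rewrite -(ler_pM2r px) -(ler_pM2r N0); nra.
Qed.

Lemma mu1plus_cube_le (r a : R) : (0 < n)%N -> 0 < r -> 0 < a ->
  pi / 2 < a * r * n%:R ->
  (mu1plus (cube n r : set 'rV[R]_n) <= (a ^+ 2 * n%:R)%:E)%E.
Proof.
move=> n0 r0 a0 ar; apply: ge_ereal_sup => _ [mu [phi [l p s]] <-].
by rewrite lee_fin; exact: supersolution_cube_le l p s.
Qed.
End cube.

(** * Measure of the ball and of the cube *)

Section boxes.
Variable R : realType.

Fixpoint prodR_box (n : nat) (I : nat -> interval R) : set (prodR R n) :=
  match n return set (prodR R n) with
  | 0 => setT
  | m.+1 => [set` I 0%N] `*` @prodR_box m (fun k => I k.+1)
  end.
Arguments prodR_box : clear implicits.

Lemma measurable_prodR_box n I : measurable (prodR_box n I).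
Proof.
by elim: n I => [|n IH] I //=; apply: measurableX => //; exact: IH.
Qed.

Lemma prod_lebesgue_boxS n I :
  (prod_lebesgue R n.+1 (prodR_box n.+1 I) =
  @lebesgue_measure R [set` I 0%N] *
    prod_lebesgue R n (prodR_box n (fun k => I k.+1)))%E.
Proof.
rewrite /= /sfprod product_measure1E//; exact: measurable_prodR_box.
Qed.

Lemma prod_lebesgue_box_gt0 n I : (forall k, (0 < @lebesgue_measure R [set` I k])%E) ->
  (0 < prod_lebesgue R n (prodR_box n I))%E.
Proof.
elim: n I => [|n IH] I I0; first by rewrite /= diracT lte01.
rewrite prod_lebesgue_boxS mule_gt0//; exact: IH.
Qed.

Lemma prod_lebesgue_box_ltoo n I :
  (forall k, (@lebesgue_measure R [set` I k] < +oo)%E) ->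
  (prod_lebesgue R n (prodR_box n I) < +oo)%E.
Proof.
elim: n I => [|n IH] I I0; first by rewrite /= diracT ltry.
rewrite prod_lebesgue_boxS lte_mul_pinfty// ?ge0_fin_numE//; exact: IH.
Qed.

Lemma row_of_prodR0 n (x : prodR R n.+1) : row_of_prodR x 0 0 = x.1.
Proof.
by rewrite /= mxE; case: splitP => [j|j] //= _; rewrite mxE ord1 eqxx.
Qed.

Lemma row_of_prodRS n (x : prodR R n.+1) (i : 'I_n) :
  row_of_prodR x 0 (lift ord0 i) = row_of_prodR x.2 0 i.
Proof.
rewrite /=.
have -> : lift ord0 i = rshift 1 i by apply/val_inj.
exact: (row_mxEr x.1%:M).
Qed.

Lemma prodR_boxE n I : prodR_box n I =
  [set x | forall i : 'I_n, row_of_prodR x 0 i \in I i].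
Proof.
elim: n I => [|n IH] I; first by apply/seteqP; split => // x _ [].
rewrite [LHS]/(_ `*` prodR_box n (fun k => I k.+1)) IH.
apply/seteqP; split => [x [x0I xI] i | x xI].
  case: (unliftP ord0 i) => [j|] ->; last by rewrite row_of_prodR0.
  by rewrite row_of_prodRS; exact: xI.
split; first by have := xI ord0; rewrite row_of_prodR0.
by move=> i; have := xI (lift ord0 i); rewrite row_of_prodRS.
Qed.

Lemma measurable_row_of_prodR n (i : 'I_n) :
  measurable_fun setT (fun x : prodR R n => row_of_prodR x 0 i).
Proof.
elim: n i => [[]//|n IH] i; case: (unliftP ord0 i) => [j|] ->.
  rewrite (_ : (fun x => _) =
    (fun x : prodR R n => row_of_prodR x 0 j) \o snd).
    by apply: measurableT_comp => //; exact: IH.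
  by apply/funext => x; exact: row_of_prodRS.
rewrite (_ : (fun x => _) = fst); first exact: measurable_fst.
by apply/funext => x; exact: row_of_prodR0.
Qed.

Lemma eballE n (rho : R) : 0 < rho ->
  eball n rho = [set x | \sum_i x 0 i ^+ 2 < rho ^+ 2].
Proof.
move=> rho0; apply/funext => x; apply/propext; rewrite /eball /=.
by rewrite -[X in _ < X <-> _](gtr0_norm rho0) -sqrtr_sqr ltr_sqrt// exprn_gt0.
Qed.

Lemma measurable_eball n (rho : R) : 0 < rho ->
  measurable (@row_of_prodR R n @^-1` eball n rho).
Proof.
move=> rho0; rewrite -[X in measurable X]setTI eballE//.
rewrite (_ : _ @^-1` _ = (fun x => \sum_i row_of_prodR x 0 i ^+ 2)
  @^-1` `]-oo, rho ^+ 2[%classic); last first.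
  by apply/seteqP; split => x /=; rewrite in_itv.
have : measurable_fun setT
  (fun x : prodR R n => \sum_i row_of_prodR x 0 i ^+ 2).
  apply: measurable_sum => i; apply: measurable_funX.
  exact: measurable_row_of_prodR.
by apply.
Qed.

Lemma preimage_cube n (r : R) :
  @row_of_prodR R n @^-1` cube n r = prodR_box n (fun=> `]- r, r[).
Proof.
by rewrite prodR_boxE; apply/seteqP; split => x xI i; have := xI i; rewrite in_itv.
Qed.

(* The ball also contains the box ]r, 5r/4[ x ]-r/2, r/2[ x ... x ]-r/2, r/2[,
   which is disjoint from the cube. *)
Lemma lt_lebesgue_cube_eball n (r rho : R) : (2 <= n)%N -> 0 < r -> 0 < rho ->
  r ^+ 2 * n%:R <= rho ^+ 2 ->
  (lebesgue_rV (cube n r) < lebesgue_rV (eball n rho))%E.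
Proof.
move=> n2 r0 rho0 rn.
pose J k := if k is 0%N then `]r, r * 5 / 4[ else `]- (r / 2), r / 2[.
have disj : prodR_box n (fun=> `]- r, r[) `&` prodR_box n J = set0.
  rewrite !prodR_boxE; apply/seteqP; split => // x [xI xJ].
  have := xI (Ordinal (ltnW n2)); have := xJ (Ordinal (ltnW n2)).
  by rewrite /= !in_itv/=; lra.
have sub : prodR_box n (fun=> `]- r, r[) `|` prodR_box n J `<=`
    @row_of_prodR R n @^-1` eball n rho.
  rewrite !prodR_boxE => x [] /= xI; rewrite eballE//= (lt_le_trans _ rn)//.
    rewrite mulr_natr -[X in _ *+ X]card_ord -sumr_const.
    have i0 : 'I_n by exists 0%N; exact: ltnW.
    apply: ltr_sum => [|i _]; first by apply/hasP; exists i0; rewrite ?mem_index_enum.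
    by have := xI i; rewrite in_itv/=; nra.
  clear disj; move: xI; case: n n2 rn x => [|[|m]]// _ rn x xI.
  rewrite big_ord_recl.
  have : \sum_(i < m.+1) row_of_prodR x 0 (lift ord0 i) ^+ 2 <=
      \sum_(i < m.+1) r ^+ 2 / 4.
    apply: ler_sum => i _; have := xI (lift ord0 i).
    by rewrite /= in_itv/=; nra.
  rewrite sumr_const card_ord -[X in _ <= X -> _]mulr_natr.
  have -> : m.+1%:R = m%:R + 1 :> R by rewrite -addn1 natrD.
  have : row_of_prodR x 0 ord0 ^+ 2 <= (r * 5 / 4) ^+ 2.
    by have := xI ord0; rewrite /= in_itv/=; nra.
  have r20 : 0 < r ^+ 2 by rewrite exprn_gt0.
  have : 0 <= m%:R * r ^+ 2 :> R by rewrite mulr_ge0// ltW.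
  move=> h0 h1 h2; rewrite (le_lt_trans (lerD h1 h2))//.
  have -> : m.+2%:R = m%:R + 2 :> R by rewrite -addn2 natrD.
  by nra.
rewrite /lebesgue_rV preimage_cube.
apply: (@lt_le_trans _ _
  (prod_lebesgue R n (prodR_box n (fun=> `]- r, r[) `|` prodR_box n J))).
  rewrite measureU//; try exact: measurable_prodR_box.
  rewrite lteDl//; last first.
    rewrite ge0_fin_numE//; apply: prod_lebesgue_box_ltoo => k.
    by rewrite lebesgue_measure_itv /=; case: ifPn => _; rewrite -?EFinB ltry.
  apply: prod_lebesgue_box_gt0 => -[|k]; rewrite lebesgue_measure_itv /= lte_fin;
    by case: ifPn; rewrite -?EFinB ?lte_fin; lra.
apply: le_measure => //; rewrite inE; last exact: measurable_eball rho0.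
by apply: measurableU; exact: measurable_prodR_box.
Qed.
End boxes.

Theorem mainTheorem2 (R : realType) (N : nat) (r rho : R) :
  (2 <= N)%N -> (0 < r)%R -> (0 < rho)%R ->
  lebesgue_rV (eball N rho) = lebesgue_rV (cube N r) ->
  (mu1plus (cube N r) < mu1plus (eball N rho))%E.
Proof.
move=> N2 r0 rho0 vol; have N0 : (0 < N)%N := ltnW N2.
pose s : R := Num.sqrt N%:R.
have s0 : 0 < s by rewrite sqrtr_gt0 ltr0n.
have s2 : N%:R = s ^+ 2 by rewrite sqr_sqrtr.
have rs0 : 0 < r * s by rewrite mulr_gt0.
have rho_lt : rho < r * s.
  rewrite ltNge; apply/negP => le.
  have : r ^+ 2 * N%:R <= rho ^+ 2 by rewrite s2 -exprMn ler_sqr// nnegrE ltW.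
  by move=> /(lt_lebesgue_cube_eball N2 r0 rho0); rewrite vol ltxx.
pose b : R := pi / (2 * rho).
have b0 : 0 < b by rewrite divr_gt0 ?pi_gt0 ?mulr_gt0.
have brho : b * rho = pi / 2 by rewrite /b; field; rewrite gt_eqF.
pose k := b * (rho + r * s) / (2 * (r * s)).
have krs : k * (r * s) = b * (rho + r * s) / 2.
  by rewrite /k; field; rewrite !gt_eqF.
have k0 : 0 < k.
  have h : 0 < rho + r * s by exact: addr_gt0.
  by apply: divr_gt0; exact: mulr_gt0.
have kb : k < b.
  by rewrite /k ltr_pdivrMr ?mulr_gt0// ltr_pM2l//; lra.
apply: le_lt_trans (lt_le_trans _ (mu1plus_eball_ge N0 rho0)).
  apply: (@mu1plus_cube_le _ _ r (k / s)) => //; first by rewrite divr_gt0.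
  rewrite -brho s2 (_ : k / s * r * s ^+ 2 = k * (r * s)).
    by rewrite krs -mulrA ltr_pM2l//; lra.
  by field; rewrite gt_eqF.
by rewrite lte_fin s2 -exprMn divfK ?gt_eqF// ltr_sqr// nnegrE ltW.
Qed.
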